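(* Let $\mathcal G$ be a loopy grid in which every cycle has length greater than $6$ and which has at least three non-leaf nodes, and let $\mathcal{GM}$ be the graphical model of the nodal phase angles under the DC power flow model with Gaussian injection fluctuations in $\mathcal G$. For every edge $(ij)$ of $\mathcal{GM}$: there exist nodes $k$ and $l$ separated by exactly $2$ hops in $\mathcal{GM}$ such that $k-i-l$ and $k-j-l$ are paths in $\mathcal{GM}$ if and only if $(ij)$ is an edge of $\mathcal G$ between non-leaf nodes $i$ and $j$ of $\mathcal G$.
   Context: Power grid: a finite connected simple undirected graph with $N$ non-reference buses and one reference bus; each line $(ij)$ has susceptance $\beta_{ij}=\beta_{ji}>0$. The reference bus is ignored in the analysis: $\mathcal G$ denotes the graph on the $N$ non-reference buses, with the lines between them as edges. ''Loopy'' means that cycles are present. Leaves are nodes of degree one in $\mathcal G$; non-leaf nodes are the others. The separation (in hops) of two nodes in a graph is the length of a shortest path between them. Reduced weighted Laplacian $H_\beta\in\mathbb R^{N\times N}$: $H_\beta(i,i)=\sum_k\beta_{ik}$ (sum over all lines at $i$, including a line to the reference bus), $H_\beta(i,j)=-\beta_{ij}$ if $(ij)$ is a line between distinct non-reference buses, and $0$ otherwise. $H_\beta$ is invertible. DC power flow model: $p=H_\beta\theta$, with $p\sim\mathcal N(0,\Sigma_p)$ the active injections, $\Sigma_p$ diagonal with positive diagonal entries, and $\theta$ the phase angles; so $\theta\sim\mathcal N(0,\Sigma_\theta)$ with $\Sigma_\theta=H_\beta^{-1}\Sigma_pH_\beta^{-1}$. The graphical model $\mathcal{GM}$ of $\theta$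 is the undirected graph on the $N$ non-reference buses in which distinct $i,j$ are adjacent if and only if $\Sigma_\theta^{-1}(i,j)\ne0$ (equivalently, the conditional independence graph of the Gaussian vector $\theta$). *)

(* Defs.v *)
From HB Require Import structures.
From mathcomp Require Import all_boot all_order all_algebra.
From mathcomp Require Import all_classical all_reals all_analysis.

Set Implicit Arguments.
Unset Strict Implicit.
Unset Printing Implicit Defensive.

Import Order.TTheory GRing.Theory Num.Theory.
Import numFieldNormedType.Exports.

Local Open Scope classical_set_scope.
Local Open Scope ring_scope.

Definition is_path (V : finType) (e : rel V) (x : V) (s : seq V) : bool :=
  path e x s && uniq (x :: s).

(* The length of the path x :: s is its number of edges, size s. *)
Definition separated_by (V : finType) (e : rel V) (n : nat) (x y : V) : Prop :=
  (exists s : seq V, [/\ is_path e x s, last x s = y & size s = n]) /\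
  (forall s : seq V, is_path e x s -> last x s = y -> (n <= size s)%N).

(* ucycle also accepts sequences of size at most 2 (an edge traversed back and
   forth, and the empty sequence); these are not cycles of a simple graph. *)
Definition is_cycle (V : finType) (e : rel V) (c : seq V) : bool :=
  ucycleb e c && (2 < size c)%N.

Definition loopy (V : finType) (e : rel V) : Prop :=
  exists c : seq V, is_cycle e c.

Definition degree (V : finType) (e : rel V) (x : V) : nat :=
  #|[set y | e x y]%SET|.

Definition leaf (V : finType) (e : rel V) (x : V) : bool :=
  degree e x == 1%N.

(* None is the reference bus. susceptance is only meaningful on lines. *)
Record power_grid (R : realType) (N : nat) := PowerGrid {
  line : rel (option 'I_N);
  susceptance : option 'I_N -> option 'I_N -> R;
  line_sym : symmetric line;
  line_irr : irreflexive line;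
  line_connected : forall x y, connect line x y;
  susceptance_sym : forall x y, susceptance x y = susceptance y x;
  susceptance_gt0 : forall x y, line x y -> 0 < susceptance x y
}.

Definition grid_graph (R : realType) (N : nat) (g : power_grid R N) :
    rel 'I_N :=
  fun i j => line g (Some i) (Some j).

(* The diagonal sum ranges over all buses, the reference bus included. *)
Definition reduced_laplacian (R : realType) (N : nat) (g : power_grid R N) :
    'M[R]_N :=
  \matrix_(i < N, j < N)
    if i == j then \sum_(k | line g (Some i) k) susceptance g (Some i) k
    else if grid_graph g i j then - susceptance g (Some i) (Some j)
    else 0.

(* normal_prob is parametrised by the standard deviation and is not the point
   mass when it is 0. *)
Definition normal_law (R : realType) (m v : R) (A : set R) : \bar R :=
  if v == 0 then dirac m A else normal_prob m (Num.sqrt v) A.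

(* X ~ N(m, S): every linear combination u^T X has law N(u^T m, u^T S u). *)
Definition gaussian_vector (R : realType) (d : measure_display)
    (Omega : measurableType d) (P : probability Omega R) (N : nat)
    (X : 'I_N -> {RV P >-> R}) (m : 'cV[R]_N) (S : 'M[R]_N) : Prop :=
  forall (u : 'cV[R]_N) (A : set R), measurable A ->
    P [set w | A (\sum_(i < N) u i ord0 * X i w)] =
    normal_law ((u^T *m m) ord0 ord0) ((u^T *m S *m u) ord0 ord0) A.

Definition dc_power_flow (R : realType) (d : measure_display)
    (Omega : measurableType d) (P : probability Omega R) (N : nat)
    (g : power_grid R N) (p theta : 'I_N -> {RV P >-> R}) : Prop :=
  forall w : Omega,
    \col_(i < N) p i w = reduced_laplacian g *m \col_(i < N) theta i w.

Definition covariance_mx (R : realType) (d : measure_display)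
    (Omega : measurableType d) (P : probability Omega R) (N : nat)
    (X : 'I_N -> {RV P >-> R}) : 'M[R]_N :=
  \matrix_(i < N, j < N) fine (covariance P (X i) (X j)).

(* invmx is the identity on singular matrices: the definition is meaningful
   when the covariance matrix of X is invertible. *)
Definition graphical_model (R : realType) (d : measure_display)
    (Omega : measurableType d) (P : probability Omega R) (N : nat)
    (X : 'I_N -> {RV P >-> R}) : rel 'I_N :=
  fun i j => (i != j) && (invmx (covariance_mx X) i j != 0).

(* Main.v *)
Require Import Defs.
From HB Require Import structures.
From mathcomp Require Import all_boot all_order all_algebra.
From mathcomp Require Import all_classical all_reals all_analysis.
From mathcomp Require Import measurable_realfun.
From mathcomp Require Import ring.
Import Order.TTheory GRing.Theory Num.Theory.
Import numFieldNormedType.Exports.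
Local Open Scope ring_scope.

Set Implicit Arguments.
Unset Strict Implicit.
Unset Printing Implicit Defensive.

(** The precision matrix of [theta] is [H D^-1 H] with [H] the reduced Laplacian
    and [D] a positive diagonal matrix.  Its terms for a line and for a common
    neighbour have opposite signs, but in a triangle-free grid they never occur
    together, so the graphical model is the square of the grid graph.  In a graph
    of girth greater than 6, three distinct nodes pairwise at distance at most 2
    lie in one closed neighbourhood.  Apply this to [i, j, k] and [i, j, l]: if
    the two centres coincide then [k] and [l] are within 2 hops in the grid;
    otherwise they must be [i] and [j], which are then adjacent, with [k] and [l]
    as further neighbours.  Conversely, further neighbours [k] of [i] and [l] of
    [j] are at distance 3 in the grid.

    The value of [D] is irrelevant, so no Gaussian moment is computed: [p i + p j]
    and [p i - p j] have the same law, hence the same variance, which makes [p i]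
    and [p j] uncorrelated. *)

(** * Common centres in the square of a graph *)

Definition square_graph (V : finType) (e : rel V) : rel V :=
  fun x y => (x != y) && (e x y || [exists z, e x z && e z y]).

Section SquareGraph.
Variables (V : finType) (e : rel V).
Hypotheses (e_sym : symmetric e) (e_irr : irreflexive e).
Hypothesis e_cycles : forall c : seq V, is_cycle e c -> (6 < size c)%N.

Let adj_neq x y : e x y -> x != y.
Proof. by apply: contraTneq => ->; rewrite e_irr. Qed.

Let no_triangle a b c : e a b -> e b c -> e c a -> False.
Proof.
move=> ab bc ca; have := e_cycles (c := [:: a; b; c]).
rewrite /is_cycle /ucycleb /= !inE !negb_or ab bc ca.
by rewrite (adj_neq ab) (adj_neq bc) eq_sym (adj_neq ca) => /(_ isT).
Qed.

(** Otherwise the closed walk [a b c d] is a 4-cycle. *)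
Let square a b c d : e a b -> e b c -> e c d -> e d a -> a != c -> b = d.
Proof.
move=> ab bc cd da ac; apply/eqP; apply/negP => /negP bd.
have := e_cycles (c := [:: a; b; c; d]).
rewrite /is_cycle /ucycleb /= !inE !negb_or ab bc cd da ac bd.
rewrite (adj_neq ab) (adj_neq bc) (adj_neq cd) (eq_sym a d) (adj_neq da) /=.
by move=> /(_ isT).
Qed.

(** No distinctness is assumed: if two non-consecutive nodes coincide, the closed walk contains a
    triangle, and otherwise it is a 5-cycle. *)
Let no_pentagon a b c d f :
  e a b -> e b c -> e c d -> e d f -> e f a -> False.
Proof.
move=> ab bc cd df fa; have := e_cycles (c := [:: a; b; c; d; f]).
have ac : a != c by apply/eqP => E; subst; apply: no_triangle cd df fa.
have bd : b != d by apply/eqP => E; subst; apply: no_triangle df fa ab.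
have cf : c != f by apply/eqP => E; subst; apply: no_triangle fa ab bc.
have ad : a != d by apply/eqP => E; subst; apply: no_triangle ab bc cd.
have bf : b != f by apply/eqP => E; subst; apply: no_triangle bc cd df.
rewrite /is_cycle /ucycleb /= !inE !negb_or ab bc cd df fa ac bd cf ad bf.
rewrite (adj_neq ab) (adj_neq bc) (adj_neq cd) (adj_neq df) (eq_sym a f).
by rewrite (adj_neq fa) => /(_ isT).
Qed.

(** A closed walk of length 6 can fold onto a tree. The distinctness of alternate nodes and of
    opposite nodes therefore has to be assumed. *)
Let no_hexagon u a v b w c :
  e u a -> e a v -> e v b -> e b w -> e w c -> e c u ->
  [&& u != v, v != w & u != w] -> [&& a != b, b != c & a != c] ->
  [&& a != w, b != u & c != v] -> False.
Proof.
move=> ua av vb bw wc cu /and3P[uv vw uw] /and3P[ab bc ac] /and3P[aw bu cv].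
have := e_cycles (c := [:: u; a; v; b; w; c]).
rewrite /is_cycle /ucycleb /= !inE !negb_or ua av vb bw wc cu uv vw uw ab bc ac.
rewrite aw (eq_sym u b) bu (eq_sym v c) cv (eq_sym u c) (adj_neq cu).
rewrite (adj_neq ua) (adj_neq av) (adj_neq vb) (adj_neq bw) (adj_neq wc).
by move=> /(_ isT).
Qed.

Let cnbhd c x := (c == x) || e c x.

Let cnbhd_refl x : cnbhd x x. Proof. by rewrite /cnbhd eqxx. Qed.
Let adj_cnbhd c x : e c x -> cnbhd c x.
Proof. by move=> E; rewrite /cnbhd E orbT. Qed.
Hint Resolve cnbhd_refl adj_cnbhd : core.

Let square_graph_sym : symmetric (square_graph e).
Proof.
move=> x y; rewrite /square_graph eq_sym e_sym; congr (_ && (_ || _)).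
by apply: eq_existsb => z; rewrite e_sym andbC e_sym.
Qed.

Let cnbhd_square_graph c x y :
  cnbhd c x -> cnbhd c y -> x != y -> square_graph e x y.
Proof.
rewrite /square_graph => /predU1P[<-|cx] /predU1P[<-|cy] xy; rewrite xy ?cy //=.
- by rewrite eqxx in xy.
- by rewrite e_sym cx.
- by apply/orP; right; apply/existsP; exists c; rewrite e_sym cx.
Qed.

(** A Helly property: distinct nodes are adjacent in the square exactly when their closed
    neighbourhoods meet. Each pair is joined by an edge or through a middle node. Two edges share an
    endpoint, which is a centre; one edge gives a pentagon; no edge gives a closed walk of length 6,
    which must degenerate. *)
Let helly u v w :
  square_graph e u v -> square_graph e v w -> square_graph e u w ->
  exists c, [/\ cnbhd c u, cnbhd c v & cnbhd c w].
Proof.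
(* One edge and two middle nodes: this case is void, since [x y a z b] is a closed walk of length
   5. *)
have one x y z a b : e x y -> e y a -> e a z -> e x b -> e b z ->
    exists c, [/\ cnbhd c x, cnbhd c y & cnbhd c z].
  move=> xy ya az xb bz; case: (@no_pentagon x y a z b) => //; by rewrite e_sym.
move=> /andP[uv /orP[euv|/existsP[a /andP[ua av]]]]
       /andP[vw /orP[evw|/existsP[b /andP[vb bw]]]]
       /andP[uw /orP[euw|/existsP[c /andP[uc cw]]]].
- by exists v; split=> //; apply: adj_cnbhd; rewrite // e_sym.
- by exists v; split=> //; apply: adj_cnbhd; rewrite // e_sym.
- by exists u; split=> //; apply: adj_cnbhd; rewrite // e_sym.
- exact: one euv vb bw uc cw.
- by exists w; split=> //; apply: adj_cnbhd; rewrite // e_sym.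
- have [d [? ? ?]] : exists c, [/\ cnbhd c v, cnbhd c w & cnbhd c u].
    by apply: (@one v w u c a); rewrite // e_sym.
  by exists d.
- have [d [? ? ?]] : exists c, [/\ cnbhd c u, cnbhd c w & cnbhd c v].
    by apply: (@one u w v b a); rewrite // e_sym.
  by exists d.
(* Every coincidence in the closed walk [u a v b w c] makes one of its nodes a common centre;
   without any, it is a 6-cycle. *)
- case: (eqVneq a b) => [E|ab].
    by subst b; exists a; split=> //; apply: adj_cnbhd; rewrite // e_sym.
  case: (eqVneq b c) => [E|bc].
    by subst c; exists b; split=> //; apply: adj_cnbhd; rewrite // e_sym.
  case: (eqVneq a c) => [E|ac].
    by subst c; exists a; split=> //; apply: adj_cnbhd; rewrite // e_sym.
  case: (eqVneq a w) => [E|aw].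
    by subst w; exists a; split=> //; apply: adj_cnbhd; rewrite // e_sym.
  case: (eqVneq b u) => [E|bu].
    by subst u; exists b; split=> //; apply: adj_cnbhd; rewrite // e_sym.
  case: (eqVneq c v) => [E|cv].
    by subst v; exists c; split=> //; apply: adj_cnbhd; rewrite // e_sym.
  case: (@no_hexagon u a v b w c) => //.
  + by rewrite e_sym.
  + by rewrite e_sym.
  + by rewrite uv vw.
  + by rewrite ab bc.
  + by rewrite aw bu.
Qed.

(** The node [m] already provides a path of length 2, so only lengths 0 and 1 have to be
    excluded. *)
Let separated2P (f : rel V) x y m : f x m -> f m y -> x != m -> m != y ->
  separated_by f 2 x y <-> x != y /\ ~~ f x y.
Proof.
move=> xm my nxm nmy; split=> [[_ far]|[xy nxy]].
  split; apply/negP; [move=> /eqP E|move=> fxy].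
    by have := far [::] isT E.
  case: (eqVneq x y) => [E|xy]; first by have := far [::] isT E.
  by have := far [:: y]; rewrite /is_path /= fxy !inE xy => /(_ isT erefl).
split.
  by exists [:: m; y]; rewrite /is_path /= xm my !inE negb_or nxm xy nmy.
case=> [|z [|? ?]] //= => [_ E|]; first by rewrite E eqxx in xy.
by rewrite /is_path /= andbT => /andP[fxz _] E; rewrite -E fxz in nxy.
Qed.

(** The neighbour [j] rules out degree 0, which [leaf] also classifies as non-leaf. *)
Let adj_nonleafP i j : e i j ->
  ~~ leaf e i <-> exists2 k, e i k & k != j.
Proof.
rewrite /leaf /degree => ij; have jN : j \in [set y | e i y] by rewrite inE.
rewrite (cardsD1 j) jN add1n eqSS cards_eq0; split.
  by case/set0Pn => k; rewrite !inE => /andP[kj ik]; exists k.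
by case=> k ik kj; apply/set0Pn; exists k; rewrite !inE kj.
Qed.

Lemma square_graph_common_path i j : square_graph e i j ->
  (exists k l, [/\ separated_by (square_graph e) 2 k l,
     is_path (square_graph e) k [:: i; l] &
     is_path (square_graph e) k [:: j; l]])
  <-> [/\ e i j, ~~ leaf e i & ~~ leaf e j].
Proof.
move=> gij; have ij : i != j by case/andP: gij.
split.
  case=> k [l []] sep.
  rewrite /is_path /= !inE !negb_or !andbT.
  move=> /andP[/andP[ki il] /andP[/andP[nki nkl] nil]].
  move=> /andP[/andP[kj jl] /andP[/andP[nkj _] njl]].
  move/(separated2P ki il nki nil): sep => [_ nkl'].
  have [c [ck ci cj]] := helly ki gij kj.
  have gjl := jl.
  have [c' [ci' cj' cl']] := helly gij jl il.
  have ncc : c != c'.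
    apply: contraNneq nkl' => E; subst c'.
    exact: cnbhd_square_graph ck cl' nkl.
  (* If neither centre is [i] or [j], both are common neighbours of [i] and [j], and [square] makes
     them equal. *)
  have eij : e i j.
    case/predU1P: ci => [E|ci].
      by subst c; case/predU1P: cj => // E; rewrite E eqxx in ij.
    case/predU1P: cj => [E|cj]; first by subst c; rewrite e_sym.
    case/predU1P: ci' => [E|ci'].
      by subst c'; case/predU1P: cj' => // E; rewrite E eqxx in ij.
    case/predU1P: cj' => [E|cj']; first by subst c'; rewrite e_sym.
    by rewrite (@square i c j c') ?eqxx // e_sym in ncc.
  (* A centre of two adjacent nodes is one of them, for lack of triangles. So one of [c], [c'] is
     [i] and the other is [j], with [k] a further neighbour of [c] and [l] one of [c']. *)
  have end_center d : cnbhd d i -> cnbhd d j -> (d = i) \/ (d = j).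
    case/predU1P=> [->|di]; first by left.
    case/predU1P=> [->|dj]; first by right.
    by case: (no_triangle di eij); rewrite e_sym.
  have eji : e j i by rewrite e_sym.
  split=> //.
    apply/(adj_nonleafP eij).
    case: (end_center _ ci cj) => E.
      subst c; exists k => //.
      by case/predU1P: ck => // E; rewrite E eqxx in nki.
    subst c; case: (end_center _ ci' cj') => E; last by rewrite E eqxx in ncc.
    subst c'; exists l; last by rewrite eq_sym.
    by case/predU1P: cl' => // E; rewrite E eqxx in nil.
  apply/(adj_nonleafP eji).
  case: (end_center _ ci cj) => E.
    subst c; case: (end_center _ ci' cj') => E; first by rewrite E eqxx in ncc.
    subst c'; exists l; last by rewrite eq_sym.
    by case/predU1P: cl' => // E; rewrite E eqxx in njl.
  subst c; exists k => //.
  by case/predU1P: ck => // E; rewrite E eqxx in nkj.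
case=> eij; have eji : e j i by rewrite e_sym.
move=> /(adj_nonleafP eij)[k eik kj] /(adj_nonleafP eji)[l ejl li].
have kl : k != l.
  apply/eqP => E; subst l; apply: (no_triangle eij ejl); by rewrite e_sym.
have ki : k != i by rewrite eq_sym adj_neq.
have jl : j != l by rewrite adj_neq.
have eki : e k i by rewrite e_sym.
have gki : square_graph e k i by rewrite /square_graph ki eki.
have gjl : square_graph e j l by rewrite /square_graph jl ejl.
have gil : square_graph e i l.
  rewrite /square_graph eq_sym li; apply/orP; right.
  by apply/existsP; exists j; rewrite eij.
have gkj : square_graph e k j.
  rewrite /square_graph kj; apply/orP; right.
  by apply/existsP; exists i; rewrite eki.
exists k, l; split.
- apply/(separated2P gki gil ki); first by rewrite eq_sym.
  (* A line between [k] and [l] would close a 4-cycle with [i] and [j], and a common neighbour [m] a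
     closed walk of length 5. *)
  split=> //; rewrite /square_graph kl negb_or; apply/andP; split.
    apply/negP => ekl; have := @square k i j l eki eij ejl.
    by rewrite e_sym => /(_ ekl kj) E; rewrite E eqxx in li.
  apply/existsP => -[m /andP[km ml]].
  by apply: (@no_pentagon k i j l m) => //; rewrite e_sym.
- by rewrite /is_path /= gki gil !inE negb_or ki kl eq_sym li.
- by rewrite /is_path /= gkj gjl !inE negb_or kj kl jl.
Qed.

Lemma triangle_free a b c : e a b -> e b c -> ~~ e c a.
Proof. by move=> ab bc; apply/negP; exact: no_triangle ab bc. Qed.

End SquareGraph.

(** * The precision matrix *)

Section Laplacian.
Variables (R : realType) (N : nat) (g : power_grid R N).
Let H := reduced_laplacian g.

Lemma grid_graph_sym : symmetric (grid_graph g).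
Proof. by move=> i j; exact: line_sym. Qed.

Lemma grid_graph_irr : irreflexive (grid_graph g).
Proof. by move=> i; exact: line_irr. Qed.

Lemma reduced_laplacian_sym : H^T = H.
Proof.
apply/matrixP => i j; rewrite !mxE eq_sym grid_graph_sym susceptance_sym.
by case: eqP => // ->.
Qed.

(** Grounding the reference bus at 0 lets the product with [H] be written with potential differences
    along all lines. *)
Let potential (v : 'rV[R]_N) (k : option 'I_N) : R :=
  if k is Some i then v 0 i else 0.

Lemma reduced_laplacian_mul (v : 'rV[R]_N) (j : 'I_N) :
  (v *m H) 0 j = \sum_(k | line g (Some j) k)
    susceptance g (Some j) k * (potential v (Some j) - potential v k).
Proof.
rewrite mxE (bigD1 j)//= mxE eqxx.
under [RHS]eq_bigr do rewrite mulrBr.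
rewrite big_split /= -mulr_suml mulrC; congr (_ + _).
(* A line to the reference bus enters only the diagonal entry of [H], since the potential there is
   0. *)
rewrite [RHS](bigID (fun k => k == None)) /=.
rewrite [X in _ = X + _]big1 ?add0r; last first.
  by move=> k /andP[_ /eqP ->]; rewrite mulr0 oppr0.
rewrite (reindex_omap Some id) /=; last by case=> [?|] /=; rewrite ?eqxx ?andbF.
rewrite (bigID (fun i => line g (Some j) (Some i))) /=.
rewrite [X in _ + X]big1 ?addr0; last first.
  move=> i /andP[ij nl]; rewrite mxE (negbTE ij).
  by rewrite grid_graph_sym /grid_graph (negbTE nl) mulr0.
apply: eq_big => [i|i /andP[ij l]].
  rewrite eqxx !andbT andbC; case l : (line _ _ _) => //=.
  by apply: contraTneq l => ->; rewrite line_irr.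
rewrite mxE (negbTE ij) grid_graph_sym /grid_graph l.
by rewrite mulrN susceptance_sym mulrC.
Qed.

(* Maximum principle: the maximal potential propagates along lines up to the
   reference bus, where it is 0. *)
Let kernel_le0 (v : 'rV[R]_N) : v *m H = 0 -> forall i, v 0 i <= 0.
Proof.
move=> vH i; pose u := potential v.
case: (@arg_maxP _ _ _ None predT u isT) => k0 _ kmax.
suff M0 : u k0 <= 0 by exact: le_trans (kmax (Some i) isT) M0.
rewrite leNgt; apply/negP => M0.
have cl : fingraph.closed (line g) [pred k | u k == u k0].
  apply: intro_closed; first exact: sym_connect_sym (@line_sym _ _ g).
  move=> [j|] k jk /eqP uj; last by move: M0; rewrite -uj ltxx.
  (* At a bus of maximal potential all terms of the vanishing sum are nonnegative, so every
     potential difference along a line is 0. *)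
  have := congr1 (fun w : 'rV_N => w 0 j) vH.
  rewrite reduced_laplacian_mul mxE => /eqP.
  rewrite psumr_eq0 => [/allP/(_ k)|l jl]; last first.
    apply: mulr_ge0; first exact/ltW/susceptance_gt0.
    by rewrite subr_ge0 [leRHS]uj; exact: kmax.
  rewrite mem_index_enum jk => /(_ isT)/=.
  rewrite mulf_eq0 gt_eqF ?susceptance_gt0//= subr_eq0 => /eqP E.
  by rewrite inE -uj eq_sym; apply/eqP.
have := closed_connect cl (line_connected g k0 None).
by rewrite !inE eqxx => /esym/eqP E; move: M0; rewrite -E ltxx.
Qed.

Lemma reduced_laplacian_unit : H \in unitmx.
Proof.
rewrite -row_free_unit; apply: inj_row_free => v vH.
apply/rowP => i; rewrite mxE; apply: le_anti; rewrite kernel_le0//=.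
have := @kernel_le0 (- v); rewrite mulNmx vH oppr0 => /(_ erefl i).
by rewrite mxE oppr_le0.
Qed.

Lemma precision_neq0 (D : 'I_N -> R) :
  (forall a b c, grid_graph g a b -> grid_graph g b c -> ~~ grid_graph g c a) ->
  (forall k, 0 < D k) ->
  forall i j, i != j ->
  (H *m diag_mx (\row_k D k) *m H) i j != 0 =
  square_graph (grid_graph g) i j.
Proof.
move=> tri D0 i j ij; rewrite /square_graph ij /=.
have HE k : (H *m diag_mx (\row_k D k)) i k = H i k * D k.
  by rewrite mul_mx_diag !mxE.
have Hdiag k l : grid_graph g k l -> 0 < H k k.
  move=> kl; rewrite mxE eqxx (bigD1 (Some l))//=.
  rewrite ltr_pwDl ?susceptance_gt0//; apply: sumr_ge0 => m /andP[km _].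
  exact/ltW/susceptance_gt0.
have Hadj k l : grid_graph g k l -> H k l < 0.
  move=> kl; rewrite mxE kl; case: eqP kl => [->|_ kl].
    by rewrite grid_graph_irr.
  by rewrite oppr_lt0 susceptance_gt0.
have Hnadj k l : k != l -> ~~ grid_graph g k l -> H k l = 0.
  by move=> kl nkl; rewrite mxE (negbTE kl) (negbTE nkl).
rewrite mxE; under eq_bigr do rewrite HE.
case: (boolP (grid_graph g i j)) => /= [eij|nij].
  (* Only [k = i] and [k = j] contribute, both with a negative term: any other contribution needs a
     common neighbour, which would close a triangle. *)
  have ji : j != i by rewrite eq_sym.
  have eji : grid_graph g j i by rewrite grid_graph_sym.
  rewrite (bigD1 i)//= (bigD1 j)//= big1 ?addr0.
    apply: ltr0_neq0; rewrite -[ltRHS]addr0 ltrD//.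
      by rewrite pmulr_rlt0 ?Hadj// mulr_gt0// (Hdiag _ _ eij).
    by rewrite nmulr_rlt0 ?(Hdiag _ _ eji)// nmulr_rlt0 ?Hadj.
  move=> k /andP[ki kj].
  case: (boolP (grid_graph g i k)) => ik; last first.
    by rewrite Hnadj ?mul0r // eq_sym.
  rewrite (Hnadj k j) ?mulr0//; apply/negP => kj'.
  by have := tri _ _ _ ik kj'; rewrite eji.
(* Without a line the terms at [i] and [j] vanish, and the others are products of two nonpositive
   entries and a positive weight. The sum is nonzero exactly when some common neighbour makes a term
   positive. *)
have term k : k != i -> k != j -> 0 <= H i k * D k * H k j.
  move=> ki kj; case: (boolP (grid_graph g i k)) => ik; last first.
    by rewrite Hnadj ?mul0r// eq_sym.
  case: (boolP (grid_graph g k j)) => kj'; last by rewrite (Hnadj k j)// mulr0.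
  by rewrite ltW// nmulr_rgt0 ?Hadj// nmulr_rlt0 ?Hadj.
have nn k : true -> 0 <= H i k * D k * H k j.
  move=> _; case: (eqVneq k i) => [->|ki]; first by rewrite (Hnadj i j)// mulr0.
  case: (eqVneq k j) => [->|kj]; last exact: term.
  by rewrite (Hnadj i j)// !mul0r.
rewrite psumr_eq0// -has_predC.
apply/hasP/existsP => [[k _ /=]|[k /andP[ik kj]]].
  move=> nz; exists k; apply/andP; split; apply: contraNT nz => n.
    case: (eqVneq k i) => [->|ki]; first by rewrite (Hnadj i j)// mulr0.
    by rewrite Hnadj ?mul0r// eq_sym.
  case: (eqVneq k j) => [->|kj]; first by rewrite (Hnadj i j)// !mul0r.
  by rewrite (Hnadj k j)// mulr0.
exists k; first by rewrite mem_index_enum.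
by rewrite /= gt_eqF// nmulr_rgt0 ?Hadj// nmulr_rlt0 ?Hadj.
Qed.

End Laplacian.

(** * Variance of normal variables *)

Section NormalMoment.
Local Open Scope classical_set_scope.
Variable R : realType.
Notation mu := (@lebesgue_measure R).

(** The normal density of doubled variance dominates the second-moment integrand. With
    [t = x ^+ 2 / (4 * s ^+ 2)] the two exponentials are [expR (- 2 * t)] and [expR (- t)], and
    [t * expR (- t) <= 1]. The quotient of peaks adjusts the normalising constants. *)
Lemma sqr_normal_pdf_le (s x : R) : s != 0 ->
  x ^+ 2 * normal_pdf 0 s x <=
  4 * s ^+ 2 * (normal_peak s / normal_peak (Num.sqrt 2 * s)) *
  normal_pdf 0 (Num.sqrt 2 * s) x.
Proof.
move=> s0; have s20 : Num.sqrt 2 * s != 0.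
  by rewrite mulf_neq0// sqrtr_eq0 -ltNge.
rewrite !normal_pdfE// /normal_fun.
have pk := normal_peak_gt0 s0; have pk2 := normal_peak_gt0 s20.
rewrite subr0 exprMn sqr_sqrtr// -(mulr_natr _ 2) -(mulr_natr (_ * _) 2).
set t := x ^+ 2 / (2 * s ^+ 2 * 2).
have sn : s ^+ 2 != 0 by rewrite expf_neq0.
have -> : - x ^+ 2 / (s ^+ 2 * 2) = - t - t by rewrite /t; field.
have -> : - x ^+ 2 / (2 * s ^+ 2 * 2) = - t by rewrite mulNr.
have -> : x ^+ 2 = 4 * s ^+ 2 * t by rewrite /t; field.
rewrite expRD.
have -> : 4 * s ^+ 2 * (normal_peak s / normal_peak (Num.sqrt 2 * s)) *
   (normal_peak (Num.sqrt 2 * s) * expR (- t)) =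
   4 * s ^+ 2 * normal_peak s * expR (- t) * 1.
  by field; rewrite gt_eqF.
have -> : 4 * s ^+ 2 * t * (normal_peak s * (expR (- t) * expR (- t))) =
   4 * s ^+ 2 * normal_peak s * expR (- t) * (t * expR (- t)) by ring.
have K0 : 0 <= 4 * s ^+ 2 * normal_peak s * expR (- t).
  by rewrite mulr_ge0 ?expR_ge0// mulr_ge0 ?normal_peak_ge0// mulr_ge0 ?sqr_ge0.
rewrite ler_wpM2l//.
(* [t <= expR t] *)
rewrite expRN -ler_pdivlMr ?invr_gt0 ?expR_gt0// invrK mul1r.
by apply: le_trans (expR_ge1Dx _); rewrite lerDr.
Qed.

Lemma normal_prob_sqr_lty (s : R) : s != 0 ->
  (\int[normal_prob 0 s]_x (x ^+ 2)%:E < +oo)%E.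
Proof.
move=> s0; pose dom := normal_prob_dominates 0 s.
have mX : measurable_fun [set: R] (EFin \o (fun x : R => x ^+ 2)).
  by apply/measurable_EFinP; exact: measurable_funX.
have mpdf r : measurable_fun [set: R] (EFin \o normal_pdf 0 r).
  by apply/measurable_EFinP; exact: measurable_normal_pdf.
rewrite -(Radon_Nikodym_SigmaFinite.change_of_variables dom)//; last first.
  by move=> x; rewrite lee_fin sqr_ge0.
pose C := 4 * s ^+ 2 * (normal_peak s / normal_peak (Num.sqrt 2 * s)).
(* The Radon-Nikodym derivative agrees almost everywhere with [normal_pdf], since both have the same
   integral over every measurable set. *)
rewrite (@ae_eq_integral _ _ _ mu _
    (fun x => (x ^+ 2)%:E * (normal_pdf 0 s x)%:E)%E)//; first last.
- apply: ae_eqe_mul2l.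
  apply: integral_ae_eq => //.
  + exact: Radon_Nikodym_SigmaFinite.f_integrable.
  + exact: mpdf.
  + move=> E _ mE; rewrite -Radon_Nikodym_SigmaFinite.f_integral//.
- apply: emeasurable_funM => //.
  exact: mpdf.
- apply: emeasurable_funM => //.
  exact: measurable_int (Radon_Nikodym_SigmaFinite.f_integrable _).
apply: (@le_lt_trans _ _
   (\int[mu]_x (C%:E * (normal_pdf 0 (Num.sqrt 2 * s) x)%:E))%E).
  apply: ge0_le_integral => //.
  - by move=> x _; rewrite -EFinM lee_fin mulr_ge0 ?sqr_ge0 ?normal_pdf_ge0.
  - apply: emeasurable_funM => //.
    exact: mpdf.
  - apply: emeasurable_funM => //.
    exact: mpdf.
  - by move=> x _; rewrite -!EFinM lee_fin sqr_normal_pdf_le.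
rewrite integralZl//; last exact: integrable_normal_pdf.
by rewrite integral_normal_pdf mule1 ltry.
Qed.

Context (d : measure_display) (Omega : measurableType d).
Variable P : probability Omega R.

Lemma Lfun2_sqr_lty (X : {RV P >-> R}) :
  (\int[P]_w (X w ^+ 2)%:E < +oo)%E -> (X : Omega -> R) \in Lfun P 2%:E.
Proof.
move=> fin; rewrite inE; apply/andP; split; rewrite inE//=.
rewrite /finite_norm unlock.
apply: poweR_lty.
under eq_integral => w _.
  rewrite /= powR_mulrn// -normrX ger0_norm ?sqr_ge0//; over.
by [].
Qed.

Lemma normal_Lfun2 (X : {RV P >-> R}) (s : R) : s != 0 ->
  (forall A, measurable A -> distribution P X A = normal_prob 0 s A) ->
  (X : Omega -> R) \in Lfun P 2%:E.
Proof.
move=> s0 XN; apply: Lfun2_sqr_lty.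
rewrite -(@ge0_integral_distribution _ _ _ _ _ P X (fun x => (x ^+ 2)%:E)).
  (* [normal_prob] lives on [measurableTypeR R], whose display differs from that
     of [R]: it is transported along the identity. *)
- pose idR : measurableTypeR R -> R := idfun.
  have mid : measurable_fun setT idR by exact: measurable_id.
  rewrite (eq_measure_integral (pushforward (normal_prob 0 s) idR)).
    rewrite ge0_integral_pushforward//; first exact: normal_prob_sqr_lty.
    + by apply/measurable_EFinP; exact: measurable_funX.
    + by move=> x _; rewrite lee_fin sqr_ge0.
  by move=> A mA _; exact: XN.
- by apply/measurable_EFinP; exact: measurable_funX.
- by move=> x; rewrite lee_fin sqr_ge0.
Qed.

(** The first two moments are integrals against the distribution, and they determine the
    variance. *)
Lemma variance_eq_distribution (X Y : {RV P >-> R}) :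
  (X : Omega -> R) \in Lfun P 2%:E -> (Y : Omega -> R) \in Lfun P 2%:E ->
  (forall A, measurable A -> distribution P X A = distribution P Y A) ->
  'V_P[X]%E = 'V_P[Y]%E.
Proof.
move=> X2 Y2 XY.
have Pfin : P setT \is a fin_num by exact: fin_num_measure.
rewrite !varianceE// [in LHS]unlock [in RHS]unlock.
have int1 (Z : {RV P >-> R}) : (Z : Omega -> R) \in Lfun P 2%:E ->
    (\int[P]_x (Z x)%:E = \int[distribution P Z]_x x%:E)%E.
  move=> Z2; rewrite (@integral_distribution _ _ _ _ _ P Z EFin)//.
  exact/Lfun1_integrable/Lfun_subset12.
have int2 (Z : {RV P >-> R}) :
    (\int[P]_x (((Z : Omega -> R) ^+ 2) x)%:E =
     \int[distribution P Z]_x (x ^+ 2)%:E)%E.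
  rewrite (@ge0_integral_distribution _ _ _ _ _ P Z (fun x => (x ^+ 2)%:E)).
  - by [].
  - by apply/measurable_EFinP; exact: measurable_funX.
  - by move=> x; rewrite lee_fin sqr_ge0.
have eqd (f : R -> \bar R) :
    (\int[distribution P X]_x f x = \int[distribution P Y]_x f x)%E.
  by apply: eq_measure_integral => A mA _; exact: XY.
congr (_ - _ ^+ 2)%E; last by rewrite !int1// eqd.
by apply: etrans (int2 X) _; rewrite eqd; exact: esym (int2 Y).
Qed.

(** A variable of variance 0 is almost surely constant, whereas a normal law is dominated by
    Lebesgue measure and gives no mass to a point. *)
Lemma variance_normal_gt0 (X : {RV P >-> R}) (s : R) : s != 0 ->
  (forall A, measurable A -> distribution P X A = normal_prob 0 s A) ->
  (0 < 'V_P[X])%E.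
Proof.
move=> s0 XN; rewrite lt0e variance_ge0 andbT; apply/eqP => V0.
pose c := fine 'E_P[X]%E.
have mXc : measurable_fun [set: Omega] (EFin \o (fun w => (X w - c) ^+ 2)).
  by apply/measurable_EFinP/measurable_funX; exact: measurable_funB.
have : ae_eq P setT (fun w => ((X w - c) ^+ 2)%:E) (cst 0%E).
  apply/ae_eq_integral_abs => //.
  under eq_integral => w _ do rewrite gee0_abs ?lee_fin ?sqr_ge0// expr2.
  by rewrite -[RHS]V0 /variance covariance.unlock [RHS]expectation_def.
case=> /= N [mN N0 sub].
have Xc0 : distribution P X [set c] = 0%E.
  rewrite XN//; apply: (normal_prob_dominates 0 s (t := [set c])) => //.
  by apply/measure0_null_setP => //; exact: lebesgue_measure_set1.
have mX : measurable (X @^-1` [set c]) by exact: measurable_funPTI.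
(* The whole space would be a union of two null sets. *)
have cover : [set: Omega] = (X @^-1` [set c]) `|` N.
  apply/seteqP; split=> // w _.
  have [Xwc|Xwc] := pselect (X w = c); first by left.
  right; apply: sub => /= /(_ I)[]/eqP.
  by rewrite sqrf_eq0 subr_eq0 => /eqP.
have PXN : (P (X @^-1` [set c]) + P N <= 0)%E.
  by have -> : P (X @^-1` [set c]) = 0%E := Xc0; rewrite N0 adde0.
have : (P setT <= 0)%E.
  by rewrite cover; exact: le_trans (measureU2 P mX mN) PXN.
by rewrite probability_setT leNgt lte01.
Qed.

End NormalMoment.

(** * Covariance of Gaussian vectors *)

Section Covariance.
Local Open Scope classical_set_scope.
Context (R : realType) (d : measure_display) (Omega : measurableType d).
Variable P : probability Omega R.

Let Pfin : P setT \is a fin_num. Proof. exact: fin_num_measure. Qed.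

Lemma Lfun2_sum (I : Type) (r : seq I) (a : I -> R) (X : I -> Omega -> R) :
  (forall k, X k \in Lfun P 2%:E) ->
  (fun w => \sum_(k <- r) a k * X k w) \in Lfun P 2%:E.
Proof.
move=> X2; elim: r => [|k r IH].
  under eq_fun do rewrite big_nil.
  exact: Lfun_cst.
under eq_fun do rewrite big_cons mulrC.
by apply: (rpredD (Lfun_scale _ _ (X2 k)) IH); rewrite ?lee1n ?ler1n.
Qed.

Lemma covariance_suml (I : Type) (r : seq I) (a : I -> R)
    (X : I -> Omega -> R) (Y : Omega -> R) :
  (forall k, X k \in Lfun P 2%:E) -> Y \in Lfun P 2%:E ->
  covariance P (fun w => \sum_(k <- r) a k * X k w) Y =
  (\sum_(k <- r) (a k)%:E * covariance P (X k) Y)%E.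
Proof.
move=> X2 Y2; elim: r => [|k r IH].
  under eq_fun do rewrite big_nil.
  by rewrite big_nil covariance_cst_l.
rewrite big_cons -IH -covarianceZl ?Lfun2_mul_Lfun1 ?Lfun_subset12//.
rewrite -covarianceDl//; last 2 first.
- by apply: Lfun_scale; rewrite ?ler1n.
- exact: Lfun2_sum.
by congr covariance; apply/funext => w; rewrite big_cons mulrC.
Qed.

Lemma covariance_mx_linear (N : nat) (K : 'M[R]_N)
    (X Y : 'I_N -> {RV P >-> R}) :
  (forall k, (X k : Omega -> R) \in Lfun P 2%:E) ->
  (forall w, \col_i Y i w = K *m \col_i X i w) ->
  covariance_mx Y = K *m covariance_mx X *m K^T.
Proof.
move=> X2 YX; apply/matrixP => i j; rewrite [LHS]mxE.
have YE l : (Y l : Omega -> R) = fun w => \sum_k K l k * X k w.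
  apply/funext => w; have := congr1 (fun v : 'cV_N => v l 0) (YX w).
  by rewrite !mxE => ->; apply: eq_bigr => k _; rewrite mxE.
have Xfin k l : covariance P (X k) (X l) \is a fin_num.
  by rewrite covariance_fin_num ?Lfun2_mul_Lfun1 ?Lfun_subset12.
have Y2 : (Y j : Omega -> R) \in Lfun P 2%:E by rewrite YE; exact: Lfun2_sum.
rewrite [X in covariance P X _](YE i) covariance_suml//.
have covXY k : covariance P (X k) (Y j) =
    (\sum_l K j l * fine (covariance P (X k) (X l)))%:E.
  rewrite covarianceC [X in covariance P X _](YE j) covariance_suml// -sumEFin.
  by apply: eq_bigr => l _; rewrite EFinM fineK// covarianceC.
under eq_bigr do rewrite covXY -EFinM.
rewrite sumEFin /= -mulmxA mxE; apply: eq_bigr => k _; congr (_ * _).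
by rewrite !mxE; apply: eq_bigr => l _; rewrite !mxE mulrC.
Qed.

Section Diagonal.
Variables (N : nat) (p : 'I_N -> {RV P >-> R}) (S : 'M[R]_N).
Hypotheses (S_diag : is_diag_mx S) (S_gt0 : forall i, 0 < S i i).
Hypothesis p_gaussian : gaussian_vector p 0 S.

(** As [u] is nonzero and the diagonal of [S] is positive, the variance is positive and [normal_law]
    is not in its Dirac case. *)
Lemma gaussian_lin_distribution (u : 'cV[R]_N) (X : {RV P >-> R}) :
  (forall w, X w = \sum_i u i 0 * p i w) -> u != 0 ->
  forall A, measurable A ->
  distribution P X A = normal_prob 0 (Num.sqrt (\sum_i u i 0 ^+ 2 * S i i)) A.
Proof.
move=> XE u0 A mA.
have quad : (u^T *m S *m u) 0 0 = \sum_i u i 0 ^+ 2 * S i i.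
  rewrite mxE; apply: eq_bigr => i _; rewrite mxE (bigD1 i)//= big1 ?addr0.
    by rewrite mxE mulrAC expr2.
  move=> j ji; have /is_diag_mxP/(_ _ _ ji) -> := S_diag.
  by rewrite mulr0.
have [i ui] : exists i, u i 0 != 0.
  apply/existsP; apply: contra_neqT u0; rewrite negb_exists => /forallP u0.
  by apply/colP => i; rewrite mxE; apply/eqP; rewrite -[_ == _]negbK.
have v0 : 0 < \sum_i u i 0 ^+ 2 * S i i.
  rewrite (bigD1 i)//= ltr_pwDl//; first by rewrite mulr_gt0// exprn_even_gt0.
  by apply: sumr_ge0 => j _; rewrite mulr_ge0 ?sqr_ge0 ?ltW.
have := p_gaussian u mA; rewrite quad mulmx0 mxE /normal_law gt_eqF// => <-.
rewrite /distribution /pushforward /=; congr (P _).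
by apply/seteqP; split => w /=; rewrite XE.
Qed.

Lemma gaussian_diag_covariance :
  [/\ forall i, (p i : Omega -> R) \in Lfun P 2%:E,
      forall i, (0 < 'V_P[p i])%E &
      forall i j, i != j -> covariance P (p i) (p j) = 0%E].
Proof.
have one i w : p i w = \sum_k (delta_mx i 0 : 'cV[R]_N) k 0 * p k w.
  rewrite (bigD1 i)//= big1 ?addr0; first by rewrite mxE !eqxx mul1r.
  by move=> k ki; rewrite mxE (negbTE ki) mul0r.
have delta_nz i : (delta_mx i 0 : 'cV[R]_N) != 0.
  by apply/eqP => /matrixP/(_ i 0)/eqP; rewrite !mxE !eqxx oner_eq0.
have s0 i : Num.sqrt (\sum_k (delta_mx i 0 : 'cV[R]_N) k 0 ^+ 2 * S k k) != 0.
  rewrite sqrtr_eq0 -ltNge (bigD1 i)//= ltr_pwDl//.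
    by rewrite mxE !eqxx expr1n mul1r.
  by apply: sumr_ge0 => j _; rewrite mulr_ge0 ?sqr_ge0 ?ltW.
have p2 i : (p i : Omega -> R) \in Lfun P 2%:E.
  exact: normal_Lfun2 (s0 i) (gaussian_lin_distribution (one i) (delta_nz i)).
split=> // [i|i j ij].
  apply: variance_normal_gt0 (s0 i) _.
  exact: gaussian_lin_distribution (one i) (delta_nz i).
have plus w : (p i \+ p j) w =
    \sum_k (delta_mx i 0 + delta_mx j 0 : 'cV[R]_N) k 0 * p k w.
  rewrite /= (one i) (one j) -big_split; apply: eq_bigr => k _ /=.
  by rewrite [in RHS]mxE mulrDl.
have minus w : (p i \- p j) w =
    \sum_k (delta_mx i 0 - delta_mx j 0 : 'cV[R]_N) k 0 * p k w.
  rewrite /= (one i) (one j) -sumrB; apply: eq_bigr => k _ /=.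
  by rewrite !mxE mulrBl.
have nz e : (delta_mx i 0 + e *: delta_mx j 0 : 'cV[R]_N) != 0.
  apply/eqP => /matrixP/(_ i 0)/eqP; rewrite !mxE !eqxx (negbTE ij).
  by rewrite mulr0 addr0 oner_eq0.
have plus_nz : (delta_mx i 0 + delta_mx j 0 : 'cV[R]_N) != 0.
  by have := nz 1; rewrite scale1r.
have minus_nz : (delta_mx i 0 - delta_mx j 0 : 'cV[R]_N) != 0.
  by have := nz (-1); rewrite scaleN1r.
have : 'V_P[(p i \+ p j)%R]%E = 'V_P[(p i \- p j)%R]%E.
  apply: variance_eq_distribution.
  - by apply: (rpredD (p2 i) (p2 j)); rewrite lee1n.
  - by apply: (rpredB (p2 i) (p2 j)); rewrite lee1n.
  move=> A mA.
  rewrite (gaussian_lin_distribution plus plus_nz mA).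
  rewrite (gaussian_lin_distribution minus minus_nz mA).
  (* The quadratic form of a diagonal [S] sees only squared coefficients, so the sign in front of
     [p j] disappears. *)
  congr (normal_prob 0 (Num.sqrt _) A); apply: eq_bigr => k _; congr (_ * _).
  rewrite !mxE eqxx !andbT; case: (eqVneq k i) => [->|_].
    by rewrite (negbTE ij) oppr0.
  by rewrite !add0r sqrrN.
rewrite varianceD// varianceB//.
have /fineK <- : 'V_P[p i]%E \is a fin_num by exact: variance_fin_num.
have /fineK <- : 'V_P[p j]%E \is a fin_num by exact: variance_fin_num.
have /fineK <- : covariance P (p i) (p j) \is a fin_num.
  by rewrite covariance_fin_num ?Lfun2_mul_Lfun1 ?Lfun_subset12.
(* Cancelling the two variances leaves twice the covariance equal to its own opposite. *)
rewrite -EFinM -EFinB -!EFinD => -[] /addrI /eqP.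
by rewrite -addr_eq0 -mulr2n mulrn_eq0 /= mulf_eq0 pnatr_eq0 /= => /eqP ->.
Qed.

Lemma gaussian_diag_covariance_mx : exists2 v : 'rV[R]_N,
  forall i, 0 < v 0 i & covariance_mx p = diag_mx v.
Proof.
have [p2 V0 cov0] := gaussian_diag_covariance.
exists (\row_i fine 'V_P[p i]%E) => [i|].
  by rewrite mxE fine_gt0// V0 ltey_eq variance_fin_num.
apply/matrixP => i j; rewrite !mxE.
by case: eqVneq => [->|ij]; rewrite ?mulr1n// mulr0n cov0.
Qed.

End Diagonal.
End Covariance.

(** * The graphical model of the phase angles *)

Lemma graphical_model_square_graph (R : realType) (d : measure_display)
    (Omega : measurableType d) (P : probability Omega R)
    (N : nat) (g : power_grid R N)
    (S : 'M[R]_N) (p theta : 'I_N -> {RV P >-> R}) :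
  is_diag_mx S -> (forall i, 0 < S i i) -> gaussian_vector p 0 S ->
  dc_power_flow g p theta ->
  (forall a b c, grid_graph g a b -> grid_graph g b c -> ~~ grid_graph g c a) ->
  graphical_model theta =2 square_graph (grid_graph g).
Proof.
move=> S_diag S_gt0 p_gaussian flow tri i j.
have [p2 _ _] := gaussian_diag_covariance S_diag S_gt0 p_gaussian.
have [v v0 covp] := gaussian_diag_covariance_mx S_diag S_gt0 p_gaussian.
set H := reduced_laplacian g.
have Hu : H \in unitmx := reduced_laplacian_unit g.
have thetaE w : \col_i theta i w = invmx H *m \col_i p i w.
  by rewrite flow mulKmx.
pose w := \row_k (v 0 k)^-1.
have vw : diag_mx v *m diag_mx w = 1%:M.
  rewrite mulmx_diag -diag_const_mx; congr diag_mx.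
  by apply/rowP => k; rewrite !mxE divff// gt_eqF.
(* This product does two things: it shows that the covariance matrix is invertible, so that [invmx]
   does not take its default value, and it identifies the inverse. *)
have covE : covariance_mx theta *m (H *m diag_mx w *m H) = 1%:M.
  rewrite (covariance_mx_linear p2 thetaE) covp trmx_inv reduced_laplacian_sym.
  by rewrite !mulmxA mulmxKV// -(mulmxA (invmx H)) vw mulmx1 mulVmx.
have covu : covariance_mx theta \in unitmx by case/mulmx1_unit: covE.
have invE : invmx (covariance_mx theta) = H *m diag_mx w *m H.
  by rewrite -[RHS](mulKmx covu) covE mulmx1.
rewrite /graphical_model invE; case: (eqVneq i j) => [->|ij] /=.
  by rewrite /square_graph eqxx.
by rewrite precision_neq0// => k; rewrite invr_gt0.
Qed.

Theorem theorem5 (R : realType) (d : measure_display)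
    (Omega : measurableType d) (P : probability Omega R)
    (N : nat) (g : power_grid R N)
    (Sigma_p : 'M[R]_N) (p theta : 'I_N -> {RV P >-> R})
    (Sigma_p_diag : is_diag_mx Sigma_p)
    (Sigma_p_gt0 : forall i : 'I_N, 0 < Sigma_p i i)
    (p_gaussian : gaussian_vector p 0 Sigma_p)
    (flow : dc_power_flow g p theta)
    (g_loopy : loopy (grid_graph g))
    (g_cycles : forall c : seq 'I_N, is_cycle (grid_graph g) c -> (6 < size c)%N)
    (g_nonleaf : (3 <= #|[set i : 'I_N | ~~ leaf (grid_graph g) i]%SET|)%N)
    (i j : 'I_N) (ij_edge : graphical_model theta i j) :
  (exists k l : 'I_N,
      [/\ separated_by (graphical_model theta) 2 k l,
          is_path (graphical_model theta) k [:: i; l] &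
          is_path (graphical_model theta) k [:: j; l]])
  <->
  [/\ grid_graph g i j, ~~ leaf (grid_graph g) i & ~~ leaf (grid_graph g) j].
Proof.
have tri := triangle_free (@grid_graph_irr _ _ g) g_cycles.
(* Equality of relations, by extensionality, allows rewriting inside [separated_by] and
   [is_path]. *)
have gmE : graphical_model theta = square_graph (grid_graph g).
  apply/funext => a; apply/funext => b.
  exact: (graphical_model_square_graph Sigma_p_diag Sigma_p_gt0 p_gaussian).
rewrite gmE in ij_edge *.
apply: square_graph_common_path => //.
- exact: grid_graph_sym.
- exact: grid_graph_irr.
Qed.
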